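(* Any ergodic system of positive entropy is isomorphic to a process none of whose finitary factors is an i.i.d. process.
   Context: A (measure preserving) system $(\mathbf{X},\mathscr{B},\mu,T)$ is a probability space $(\mathbf{X},\mathscr{B},\mu)$ endowed with a measure preserving transformation $T$; entropy means Kolmogorov–Sinai entropy. A factor map from $(\mathbf{X},\mathscr{B},\mu,T_{\mathbf X})$ to $(\mathbf{Y},\mathscr{C},\nu,T_{\mathbf Y})$ is a measurable map $\phi:\mathbf{X}\to\mathbf{Y}$ with $\phi\circ T_{\mathbf X}=T_{\mathbf Y}\circ\phi$ and $\phi_*\mu=\nu$; it is an isomorphism if it is invertible, and then the two systems are said to be isomorphic (as usual, equalities and invertibility are understood modulo null sets). A process $(A^{\mathbb{Z}},\mu)$ is a system whose space is $A^{\mathbb{Z}}$ for some set $A$ and whose transformation is the left shift $S$, $(Sx)_n=x_{n+1}$. An i.i.d. process is a process $(B^{\mathbb{Z}},p^{\times\mathbb{Z}})$, where $p=(p_b)_{b\in B}$ is a probability measure on $B$ and $p^{\times\mathbb{Z}}$ is the product measure. For processes $(A^{\mathbb{Z}},\mu)$ and $(B^{\mathbb{Z}},\nu)$ and a factor map $\phi:A^{\mathbb{Z}}\to B^{\mathbb{Z}}$, let $\phi_0(x)=\phi(x)_0$. The factor map $\phi$ is finitary if for $\mu$-a.e. $x\in A^{\mathbb{Z}}$ there is $r=r(x)$ such that $\phi_0$ is constant up to $\mu$-measure zero on the cylinder $\{x'\in A^{\mathbb{Z}}: x'_i=x_i \text{ for all } -r\le i\le r\}$. In this case $(B^{\mathbb{Z}},\nu)$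 is called a finitary factor of $(A^{\mathbb{Z}},\mu)$.
   Formalization: The system is assumed to be an invertible (mod null sets) transformation of a standard probability space, and the i.i.d. process is assumed not to be the trivial one-point process; without these the claim fails (e.g. one-sided Bernoulli shift, constant factor). *)

(* Defs.v *)
From HB Require Import structures.
From mathcomp Require Export all_boot all_order all_algebra.
From mathcomp Require Export all_classical all_reals all_analysis.

Set Implicit Arguments.
Unset Strict Implicit.
Unset Printing Implicit Defensive.

Import Order.TTheory GRing.Theory Num.Theory.
Import numFieldNormedType.Exports.

Local Open Scope classical_set_scope.
Local Open Scope ring_scope.

(* Probability spaces are standard (Lebesgue) spaces: off a null set, the
   space is Borel isomorphic to a Borel subset of the line. *)
Definition standard_probability (R : realType) (d : measure_display)
    (X : measurableType d) (mu : probability X R) : Prop :=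
  exists (D : set X) (f : X -> R),
    [/\ measurable D, mu (~` D) = 0%E, measurable_fun D f,
        {in D &, injective f} &
        forall E : set X, measurable E -> E `<=` D -> measurable (f @` E)].

Definition measure_preserving (R : realType) (d : measure_display)
    (X : measurableType d) (mu : probability X R) (T : X -> X) : Prop :=
  measurable_fun [set: X] T /\
  forall E : set X, measurable E -> mu (T @^-1` E) = mu E.

Definition ergodic (R : realType) (d : measure_display)
    (X : measurableType d) (mu : probability X R) (T : X -> X) : Prop :=
  forall E : set X, measurable E -> T @^-1` E = E ->
    mu E = 0%E \/ mu E = 1%E.

Definition invertible_mod0 (R : realType) (d d' : measure_display)
    (X : measurableType d) (Y : measurableType d')
    (mu : probability X R) (nu : probability Y R) (phi : X -> Y) : Prop :=
  exists psi : Y -> X,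
    [/\ measurable_fun [set: Y] psi,
        {ae mu, forall x, psi (phi x) = x} &
        {ae nu, forall y, phi (psi y) = y}].

Definition factor_map (R : realType) (d d' : measure_display)
    (X : measurableType d) (Y : measurableType d')
    (mu : probability X R) (T : X -> X)
    (nu : probability Y R) (U : Y -> Y) (phi : X -> Y) : Prop :=
  [/\ measurable_fun [set: X] phi,
      {ae mu, forall x, phi (T x) = U (phi x)} &
      forall E : set Y, measurable E -> mu (phi @^-1` E) = nu E].

Definition isomorphic (R : realType) (d d' : measure_display)
    (X : measurableType d) (Y : measurableType d')
    (mu : probability X R) (T : X -> X)
    (nu : probability Y R) (U : Y -> Y) : Prop :=
  exists phi : X -> Y,
    factor_map mu T nu U phi /\ invertible_mod0 mu nu phi.

(* A finite partition of X is given by its labelling function P : X -> F; the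
   convention 0 ln 0 = 0 is automatic. *)
Definition partition_entropy (R : realType) (d : measure_display)
    (X : measurableType d) (mu : probability X R)
    (F : finType) (P : X -> F) : R :=
  - \sum_(a : F) (let q := fine (mu (P @^-1` [set a])) in q * ln q).

(* The labelling function of the join of P, T^-1 P, ..., T^-(n-1) P. *)
Definition itinerary (X : Type) (T : X -> X) (F : finType) (P : X -> F)
    (n : nat) (x : X) : {ffun 'I_n -> F} :=
  [ffun i : 'I_n => P (iter i T x)].

Definition entropy_rate (R : realType) (d : measure_display)
    (X : measurableType d) (mu : probability X R) (T : X -> X)
    (F : finType) (P : X -> F) : R :=
  limn (fun n : nat => partition_entropy mu (@itinerary X T F P n) / n%:R).

Definition ks_entropy (R : realType) (d : measure_display)
    (X : measurableType d) (mu : probability X R) (T : X -> X) : \bar R :=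
  ereal_sup [set h : \bar R | exists (k : nat) (P : X -> 'I_k),
    (forall j : 'I_k, measurable (P @^-1` [set j])) /\
    h = (entropy_rate mu T P)%:E].

(* A^Z with the product sigma-algebra, each copy of the alphabet A carrying
   the sigma-algebra of all its subsets. *)
Definition coordinate_sets (A : pointedType) : set (set (int -> A)) :=
  [set C | exists (i : int) (E : set A), C = [set x | E (x i)]].

Definition bisequence (A : pointedType) :=
  g_sigma_algebraType (@coordinate_sets A).

Definition left_shift (A : pointedType) (x : bisequence A) : bisequence A :=
  fun n : int => x (n + 1).

(* rho is the product measure p^Z on B^Z, characterised by its values on
   finite-dimensional rectangles. *)
Definition iid_process (R : realType) (B : pointedType) (p : B -> R)
    (rho : probability (bisequence B) R) : Prop :=
  [/\ forall b : B, 0 <= p b,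
      (\esum_(b in [set: B]) (p b)%:E = 1)%E &
      forall (s : seq int) (E : int -> set B), uniq s ->
        rho [set x : bisequence B | forall i : int, i \in s -> E i (x i)] =
        (\prod_(i <- s) \esum_(b in E i) (p b)%:E)%E].

Definition finitary (R : realType) (A B : pointedType)
    (mu : probability (bisequence A) R)
    (phi : bisequence A -> bisequence B) : Prop :=
  {ae mu, forall x : bisequence A, exists (r : nat) (b : B),
    {ae mu, forall x' : bisequence A,
      (forall i : int, - r%:Z <= i <= r%:Z -> x' i = x i) ->
      phi x' 0 = b}}.

Definition finitary_factor (R : realType) (A B : pointedType)
    (mu : probability (bisequence A) R)
    (nu : probability (bisequence B) R) : Prop :=
  exists phi : bisequence A -> bisequence B,
    factor_map mu (@left_shift A) nu (@left_shift B) phi /\ finitary mu phi.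

(* Main.v *)
Require Import Defs.
From HB Require Import structures.
From mathcomp Require Import measurable_realfun ring lra zify.
Set Implicit Arguments.
Unset Strict Implicit.
Unset Printing Implicit Defensive.
Import Order.TTheory GRing.Theory Num.Theory.
Import numFieldNormedType.Exports.
Local Open Scope classical_set_scope.
Local Open Scope ring_scope.

(* If [phi] is a finitary factor map onto an i.i.d. process, some window [w]
   forces a letter [b] at the origin, so the word [w^k] forces [b] at [k]
   places and has probability at most [p b ^ k].  It therefore suffices to
   code the system by a countable generating partition for which, for every
   finite word [w], the probability of [w^k] does not decay exponentially
   in [k].

   List all words as [w_0, w_1, ...].  Stage [j] takes a Rokhlin tower much
   higher than [n = |w_j| k_j] but with base of measure at least a constant
   (known before [k_j] is chosen) over [n], for [k_j] so large that this exceeds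
   an exponential in [k_j] with ratio close to 1.  On its first [n] levels the
   points are relabelled so that they spell
   [w_j^k_j]; on level [n] the label is a code letter of kind [j] recording the
   first digits of a coordinate [f] along a long piece of the past orbit.  Later
   stages overwrite earlier ones, but are so small that most of stage [j]
   survives.  Almost every point meets level [n] of stage [j] within [t_j]
   steps, which for all large [j] is long enough to read [f] off the name, so
   the labelling generates.  An infinite alphabet makes the amount of recorded
   information harmless.

   Positive entropy only serves to produce sets of arbitrarily small positive
   measure. *)

(** * Measurable predicates and probabilities *)

Section measurable_predicates.
Context (d : measure_display) (X : measurableType d).
Implicit Types P Q : X -> Prop.

Lemma meas_const (P : Prop) : measurable [set _ : X | P].
Proof.
have [p|np] := pselect P.
  by rewrite (_ : mkset _ = setT)//; apply/seteqP; split.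
by rewrite (_ : mkset _ = set0)//; apply/seteqP; split.
Qed.

Lemma meas_not P : measurable [set x | P x] -> measurable [set x | ~ P x].
Proof. exact: measurableC. Qed.

Lemma meas_and P Q : measurable [set x | P x] -> measurable [set x | Q x] ->
  measurable [set x | P x /\ Q x].
Proof. exact: measurableI. Qed.

Lemma meas_or P Q : measurable [set x | P x] -> measurable [set x | Q x] ->
  measurable [set x | P x \/ Q x].
Proof. exact: measurableU. Qed.

Lemma meas_imp P Q : measurable [set x | P x] -> measurable [set x | Q x] ->
  measurable [set x | P x -> Q x].
Proof.
move=> mP mQ; rewrite (_ : mkset _ = [set x | ~ P x \/ Q x]).
  by apply: meas_or => //; exact: meas_not.
apply/seteqP; split=> x /=; last by move=> [].
by have [p|np] := pselect (P x); [right; auto|left].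
Qed.

Lemma meas_ex (I : countType) (P : I -> X -> Prop) :
  (forall i, measurable [set x | P i x]) -> measurable [set x | exists i, P i x].
Proof.
move=> mP; rewrite (_ : mkset _ = \bigcup_i [set x | P i x]).
  by apply: countable_bigcupT_measurable => //; exact: countableP.
by apply/seteqP; split=> x /= [i]; exists i.
Qed.

Lemma meas_all (I : countType) (P : I -> X -> Prop) :
  (forall i, measurable [set x | P i x]) -> measurable [set x | forall i, P i x].
Proof.
move=> mP; rewrite (_ : mkset _ = [set x | ~ exists i, ~ P i x]).
  by apply: meas_not; apply: meas_ex => i; exact: meas_not.
apply/seteqP; split=> x /= h; first by move=> [i]; apply; exact: h.
by move=> i; apply: contrapT => ni; apply: h; exists i.
Qed.

Lemma meas_ex_lt (n : nat) (P : nat -> X -> Prop) :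
  (forall i, measurable [set x | P i x]) ->
  measurable [set x | exists2 i, (i < n)%N & P i x].
Proof.
move=> mP; rewrite (_ : mkset _ = [set x | exists i, (i < n)%N /\ P i x]).
  by apply: meas_ex => i; apply: meas_and => //; exact: meas_const.
by apply/seteqP; split=> x /= [i]; [exists i|case; exists i].
Qed.

Lemma meas_all_lt (n : nat) (P : nat -> X -> Prop) :
  (forall i, measurable [set x | P i x]) ->
  measurable [set x | forall i, (i < n)%N -> P i x].
Proof.
move=> mP; apply: meas_all => i; apply: meas_imp => //; exact: meas_const.
Qed.

Lemma meas_preim (d' : measure_display) (Y : measurableType d') (f : X -> Y)
    (P : Y -> Prop) : measurable_fun setT f -> measurable [set y | P y] ->
  measurable [set x | P (f x)].
Proof. by move=> mf mP; rewrite -[mkset _]setTI; exact: mf. Qed.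

(** For countable [C] this is measurability for the discrete sigma-algebra, with no measurable
    structure put on [C]. *)
Definition measurable_fibers (C : Type) (c : X -> C) :=
  forall s, measurable [set x | c x = s].

Lemma fibers_preim (C : countType) (c : X -> C) (P : C -> Prop) :
  measurable_fibers c -> measurable [set x | P (c x)].
Proof.
move=> mc; rewrite (_ : mkset _ = [set x | exists s, P s /\ c x = s]).
  by apply: meas_ex => s; apply: meas_and => //; exact: meas_const.
by apply/seteqP; split=> x /=; [exists (c x)|move=> [s [Ps ->]]].
Qed.

Lemma fibers_comp (C : countType) (C' : Type) (c : X -> C) (g : C -> C') :
  measurable_fibers c -> measurable_fibers (g \o c).
Proof. by move=> mc s; exact: (fibers_preim (fun a => g a = s) mc). Qed.

Lemma fibers_measurable (C : countType) (d' : measure_display)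
    (Y : measurableType d') (c : X -> C) (g : C -> Y) :
  measurable_fibers c -> measurable_fun setT (g \o c).
Proof.
move=> mc _ B mB; rewrite setTI.
exact: (fibers_preim (fun a => B (g a)) mc).
Qed.

Lemma fibers_mkseq (C : countType) (c : nat -> X -> C) (n : nat) :
  (forall i, measurable_fibers (c i)) -> measurable_fibers (fun x => mkseq (c^~ x) n).
Proof.
(* [ohead (drop i s)] reads the [i]-th entry without a default, since [C] may be empty. *)
move=> mc s; rewrite (_ : mkset _ =
  [set x | size s = n /\ forall i, (i < n)%N -> ohead (drop i s) = Some (c i x)]).
  apply: meas_and; first exact: meas_const.
  apply: meas_all_lt => i.
  exact: (fibers_preim (fun a => ohead (drop i s) = Some a) (mc i)).
apply/seteqP; split=> x /=.
  move=> <-; rewrite size_mkseq; split => // i ilt.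
  by rewrite (drop_nth (c 0 x)) ?size_mkseq//= nth_mkseq.
move=> [ss h]; apply: (@eq_from_nth _ (c 0 x)); rewrite size_mkseq// => i ilt.
rewrite nth_mkseq//; have := h _ ilt.
by rewrite (drop_nth (c 0 x)) ?ss//= => -[].
Qed.

End measurable_predicates.

Lemma fibers_pull (d d' : measure_display) (X : measurableType d)
    (Y : measurableType d') (f : Y -> X) (C : Type) (c : X -> C) :
  measurable_fun setT f -> measurable_fibers c -> measurable_fibers (c \o f).
Proof. by move=> mf mc s; apply: (meas_preim mf (mc s)). Qed.

Section probability_reals.
Context (R : realType) (d : measure_display) (X : measurableType d)
  (mu : probability X R).
Implicit Types E F : set X.

Definition pr E : R := fine (mu E).

Lemma prE E : measurable E -> mu E = (pr E)%:E.
Proof. by move=> mE; rewrite /pr fineK// fin_num_measure. Qed.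

Lemma pr_ge0 E : 0 <= pr E.
Proof. by rewrite /pr fine_ge0. Qed.

Lemma le_pr E F : measurable E -> measurable F -> E `<=` F -> pr E <= pr F.
Proof.
move=> mE mF EF; rewrite -lee_fin -!prE//; apply: le_measure => //; exact/mem_set.
Qed.

Lemma pr_setT : pr setT = 1.
Proof. by rewrite /pr probability_setT. Qed.

Lemma pr_le1 E : measurable E -> pr E <= 1.
Proof. by move=> mE; rewrite -pr_setT; exact: le_pr. Qed.

Lemma pr_setC E : measurable E -> pr (~` E) = 1 - pr E.
Proof.
move=> mE; apply: EFin_inj; rewrite -prE; last exact: measurableC.
by rewrite probability_setC// prE.
Qed.

Lemma pr_setU E F : measurable E -> measurable F -> pr (E `|` F) <= pr E + pr F.
Proof.
move=> mE mF; rewrite -lee_fin EFinD -!prE//; last exact: measurableU.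
exact: measureU2.
Qed.

Lemma pr_cover E F G : measurable E -> measurable F -> measurable G ->
  E `<=` F `|` G -> pr E <= pr F + pr G.
Proof.
move=> mE mF mG EFG; apply: le_trans (pr_setU mF mG).
by apply: le_pr => //; exact: measurableU.
Qed.

Lemma pr_ex_lt (n : nat) (P : nat -> X -> Prop) (c : R) :
  (forall i, measurable [set x | P i x]) ->
  (forall i, (i < n)%N -> pr [set x | P i x] <= c) ->
  pr [set x | exists2 i, (i < n)%N & P i x] <= n%:R * c.
Proof.
move=> mP; elim: n => [|n IH] h.
  rewrite (_ : mkset _ = set0) ?mul0r; first by rewrite /pr measure0.
  by apply/seteqP; split=> x // -[].
rewrite -natr1 mulrDl mul1r; apply: (le_trans _ (lerD (IH _) (h n _))) => //.
  apply: pr_cover => //; try exact: meas_ex_lt.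
  move=> x /= [i]; rewrite ltnS leq_eqVlt => /orP[/eqP->|ilt] Px; first by right.
  by left; exists i.
by move=> i ilt; apply: h; rewrite ltnS ltnW.
Qed.

Lemma pr_bigcup_geometric (U : nat -> set X) (c : R) : 0 <= c ->
  (forall j, measurable (U j)) -> (forall j, pr (U j) <= c / (2 ^ j.+1)%:R) ->
  pr (\bigcup_j U j) <= c.
Proof.
move=> c0 mU Uc; have mUU : measurable (\bigcup_j U j) by exact: bigcupT_measurable.
rewrite -lee_fin -prE//; apply: le_trans (generalized_Boole_inequality mu mU mUU) _.
apply: le_trans (epsilon_trick0 xpredT c0); apply: lee_nneseries => // j _.
by have := Uc j; rewrite -lee_fin -prE.
Qed.

Lemma pr_sum_fibers (F : finType) (P : X -> F) : measurable_fibers P ->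
  \sum_(a : F) pr (P @^-1` [set a]) = 1.
Proof.
move=> mP; have mP' a : a \in [set` index_enum F] -> measurable (P @^-1` [set a]).
  by move=> _; exact: mP.
have tP : trivIset [set` index_enum F] (fun a => P @^-1` [set a]).
  by move=> a b _ _ [x [/= <- <-]].
have h : (\sum_(a \in [set` index_enum F]) mu (P @^-1` [set a]) = 1)%E.
  rewrite -[LHS](measure_fin_bigcup mu (finite_seq (index_enum F)) tP (fun a _ => mP a)).
  rewrite (_ : \bigcup_(i in _) _ = setT); first exact: probability_setT.
  by apply/seteqP; split=> x // _; exists (P x) => //=; exact: mem_index_enum.
apply: EFin_inj; rewrite -h -sumEFin -fsbig_seq ?index_enum_uniq//.
by apply: eq_bigr => a _; rewrite -prE//; exact: mP.
Qed.

End probability_reals.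

(** * Sets of small measure from positive entropy *)

Section small_sets.
Context (R : realType) (d : measure_display) (X : measurableType d)
  (mu : probability X R).

Lemma meas_iter (T : X -> X) n : measurable_fun setT T ->
  measurable_fun setT (iter n T).
Proof.
move=> mT; elim: n => [|n IH]; first exact: measurable_id.
by rewrite (_ : iter _ _ = T \o iter n T)//; exact: measurableT_comp.
Qed.

Lemma fibers_itinerary (T : X -> X) (F : finType) (P : X -> F) n :
  measurable_fun setT T -> measurable_fibers P ->
  measurable_fibers (@itinerary X T F P n).
Proof.
move=> mT mP s; rewrite (_ : mkset _ =
  [set x | forall i : 'I_n, P (iter i T x) = s i]).
  apply: meas_all => i; exact: (fibers_pull (meas_iter i mT) mP).
apply/seteqP; split=> x /=; first by move=> <- i; rewrite ffunE.
by move=> h; apply/ffunP => i; rewrite ffunE.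
Qed.

(** Each [- ln q] with [q] nonzero is at most [- ln e], and the weights [q] sum to 1, whatever the
    number of atoms. *)
Lemma partition_entropy_le (F : finType) (P : X -> F) (e : R) :
  measurable_fibers P -> 0 < e <= 1 ->
  (forall a, pr mu (P @^-1` [set a]) = 0 \/ e <= pr mu (P @^-1` [set a])) ->
  0 <= partition_entropy mu P <= - ln e.
Proof.
move=> mP /andP[e0 e1] he; rewrite /partition_entropy -sumrN; apply/andP; split.
  apply: sumr_ge0 => a _ /=; rewrite -/(pr mu _).
  have := @pr_le1 _ _ _ mu _ (mP a); case: (he a) => h; first by rewrite h mul0r oppr0.
  by move=> h1; rewrite oppr_ge0 mulr_ge0_le0 ?pr_ge0// ln_le0.
rewrite -[leRHS]mul1r -(pr_sum_fibers mu mP) mulr_suml; apply: ler_sum => a _ /=.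
rewrite -/(pr mu _); case: (he a) => [->|h]; first by rewrite !mul0r oppr0.
by rewrite -mulrN ler_wpM2l ?pr_ge0// lerN2 ler_ln ?posrE// (lt_le_trans e0).
Qed.

(** If no set had measure strictly between 0 and some bound, the joins of any partition would have
    entropy bounded independently of [n], and every entropy rate would vanish. *)
Lemma entropy_small_sets (T : X -> X) : measurable_fun setT T ->
  (0 < ks_entropy mu T)%E ->
  forall e : R, 0 < e -> exists2 E : set X, measurable E & 0 < pr mu E < e.
Proof.
move=> mT hent e0 e0gt; apply: contrapT => nE.
pose e := Num.min e0 1.
have egt : 0 < e by rewrite lt_min e0gt ltr01.
have ele : e <= 1 by rewrite ge_min lexx orbT.
have he E : measurable E -> pr mu E = 0 \/ e <= pr mu E.
  move=> mE; have [h|h] := leP e (pr mu E); [by right|left].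
  apply: contrapT => /eqP h0; apply: nE; exists E => //.
  by rewrite lt_neqAle eq_sym h0 pr_ge0 (lt_le_trans h)// ge_min lexx.
move: hent; apply/negP; rewrite -leNgt; apply: ge_ereal_sup => _ [k [P [mP ->]]].
rewrite lee_fin le_eqVlt; apply/orP; left; apply/eqP.
apply: cvg_lim => //.
have hb n : 0 <= partition_entropy mu (@itinerary X T _ P n) <= - ln e.
  apply: partition_entropy_le; rewrite ?egt//.
    exact: fibers_itinerary.
  by move=> a; apply: he; exact: fibers_itinerary.
apply: (@squeeze_cvgr _ _ _ _ (cst 0) (fun n : nat => - ln e / n%:R)).
- apply: nearW => n; have /andP[h1 h2] := hb n.
  by rewrite divr_ge0//= ler_wpM2r// invr_ge0.
- exact: cvg_cst.
- rewrite -[X in _ --> X](mulr0 (- ln e)); apply: cvgMr.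
  rewrite -cvg_shiftS. exact: cvg_harmonic.
Qed.

End small_sets.

(** * Recurrence and towers *)

(** Continuity of the measure from below, along the finite unions. *)
Lemma pr_ex_approx (R : realType) (d : measure_display) (X : measurableType d)
    (mu : probability X R) (P : nat -> X -> Prop) (e : R) :
  (forall i, measurable [set x | P i x]) -> 0 < e ->
  exists t : nat, pr mu [set x | exists i, P i x] - e <
    pr mu [set x | exists2 i, (i < t)%N & P i x].
Proof.
move=> mP e0; pose F n := [set x | exists2 i, (i < n)%N & P i x].
have mF n : measurable (F n) by exact: meas_ex_lt.
have mU : measurable (\bigcup_n F n) by exact: bigcupT_measurable.
have UE : \bigcup_n F n = [set x | exists i, P i x].
  apply/seteqP; split=> x /=; first by move=> [n _ [i _ ?]]; exists i.
  by move=> [i ?]; exists i.+1 => //; exists i.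
have hF : {homo F : n m / (n <= m)%N >-> (n <= m)%O}.
  move=> n m nm; apply/subsetPset => x [i ilt ?]; exists i => //.
  exact: leq_trans nm.
have h : (fun n => pr mu (F n)) @ \oo --> pr mu (\bigcup_n F n).
  apply: fine_cvg; rewrite -prE//.
  exact: (@nondecreasing_cvg_mu _ _ _ mu _ mF mU hF).
move/cvgrPdist_lt : h => /(_ e e0); rewrite UE => -[t _ /(_ t (leqnn t))] /= ht.
by exists t; move: ht => /ltr_normlP[]; lra.
Qed.

(** With [t + 1] and [t] the hitting times of [x] and [T x], this says that the level grows by one
    modulo [N]. *)
Lemma modn_countdown (N t : nat) : (0 < N)%N ->
  ((N - t %% N) %% N)%N = (((N - t.+1 %% N) %% N).+1 %% N)%N.
Proof.
move=> N0; rewrite -(addn1 t) -modnDml.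
have := ltn_pmod t N0; move: (t %% N)%N => s sN.
rewrite -addn1 modnDml; have [e|e] := eqVneq (s + 1)%N N.
  by rewrite e modnn subn0 modnDl; congr modn; lia.
by rewrite (modn_small (m := (s + 1)%N)); [congr modn; lia|lia].
Qed.

Section recurrence.
Context (R : realType) (d : measure_display) (X : measurableType d)
  (mu : probability X R) (T : X -> X).
Hypotheses (Tpres : measure_preserving mu T) (Terg : ergodic mu T).

Let mT : measurable_fun setT T := Tpres.1.

Lemma pr_iter n (P : X -> Prop) : measurable [set x | P x] ->
  pr mu [set x | P (iter n T x)] = pr mu [set x | P x].
Proof.
move=> mP; elim: n => [//|n <-].
transitivity (pr mu (T @^-1` [set x | P (iter n T x)])).
  congr pr; apply/seteqP; split=> x /=; by rewrite -iterSr.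
by rewrite /pr Tpres.2//; exact: (meas_preim (meas_iter n mT)).
Qed.

Lemma ae_iter n (P : X -> Prop) : {ae mu, forall x, P x} ->
  {ae mu, forall x, P (iter n T x)}.
Proof.
move=> [N [mN N0 hN]]; exists [set x | N (iter n T x)]; split.
- exact: (meas_preim (meas_iter n mT)).
- have mNn : measurable [set x | N (iter n T x)] by exact: (meas_preim (meas_iter n mT)).
  transitivity (pr mu [set x | N (iter n T x)])%:E; first exact: prE.
  by rewrite (@pr_iter n N mN) -[RHS]N0; apply/esym; exact: prE.
- by move=> x /= h; exact: hN.
Qed.

(** The points that visit [P] at or after time [n] form decreasing sets [V n] of equal measure, so
    infinitely many visits are as likely as one. Ergodicity applies to the intersection, whose
    measure is at least that of [P]. *)
Lemma hits_ae (P : X -> Prop) : measurable [set x | P x] ->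
  0 < pr mu [set x | P x] -> pr mu [set x | exists i, P (iter i T x)] = 1.
Proof.
move=> mP P0; have mi n : measurable [set x | P (iter n T x)].
  exact: (meas_preim (meas_iter n mT)).
pose V n := [set x | exists i, P (iter i T (iter n T x))].
have mE : measurable [set x | exists i, P (iter i T x)] by exact: meas_ex.
have mV n : measurable (V n) by exact: (meas_preim (meas_iter n mT) mE).
have mV' : measurable (\bigcap_n V n) by exact: bigcapT_measurable.
have hV : {homo V : n m / (n <= m)%N >-> (m <= n)%O}.
  move=> n m nm; apply/subsetPset => x [i h]; exists (i + (m - n))%N.
  by move: h; rewrite -!iterD -addnA subnK.
have prV n : mu (V n) = mu (V 0%N).
  rewrite !prE//; congr EFin.
  by rewrite (@pr_iter n (fun x => exists i, P (iter i T x))).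
have fV : (mu (V 0%N) < +oo)%E by rewrite prE// ltry.
have := @nonincreasing_cvg_mu _ _ _ mu _ fV mV mV' hV.
rewrite (_ : mu \o V = cst (mu (V 0%N))); last by apply/funext => n; exact: prV.
move=> h; have {}h : mu (\bigcap_n V n) = mu (V 0%N).
  by apply: (cvg_unique _ h (cvg_cst _)).
(* [ergodic] asks for exact invariance, which holds for infinitely many visits but can fail for
   [V 0]. *)
have inv : T @^-1` (\bigcap_n V n) = \bigcap_n V n.
  apply/seteqP; split=> x hx n _.
    by have [i hi] := hx n I; exists i.+1; rewrite iterSr -iterS iterSr.
  by have [i hi] := hx n.+1 I; exists i; rewrite -iterSr.
have := Terg mV' inv; rewrite h (prE _ (mV 0%N)) => -[] [] //.
move=> h0; exfalso; move: P0; rewrite lt_neqAle => /andP[/eqP[]].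
apply/eqP; rewrite eq_le pr_ge0 -h0/=; apply: le_pr => // x hx.
by exists 0%N.
Qed.

(** * A tower of height [N] below the visits to a small set *)

Section tower.
Variables (N' : nat).
Let N := N'.+1.
Variables (F : X -> Prop).
Hypotheses (mF : measurable [set x | F x]).

Let first (x : X) : set nat :=
  [set m | F (iter m T x) /\ forall l, (l < m)%N -> ~ F (iter l T x)].
Let hit (x : X) : Prop := exists m, F (iter m T x).
(** On orbits that never meet [F], the default value of [get] makes this [0]. *)
Let tau (x : X) : nat := get (first x).
(** On an orbit that meets [F], the map [T] raises the level by one modulo [N] at each point outside
    [F]; only at a visit can the level jump. *)
Let lev (x : X) : nat := ((N - tau x %% N) %% N)%N.

Let mFi m : measurable [set x | F (iter m T x)].
Proof. exact: (meas_preim (meas_iter m mT)). Qed.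

Let firstP x : hit x -> first x (tau x).
Proof.
move=> hx; apply: getPex.
case: hx => m; elim/ltn_ind: m => m IH hm.
have [[l lm hl]|nl] := pselect (exists2 l, (l < m)%N & F (iter l T x)).
  exact: IH hl.
by exists m; split => // l lm hl; apply: nl; exists l.
Qed.

Let first_uniq x m : first x m -> tau x = m.
Proof.
move=> hm; have [h1 h2] : first x (tau x) by apply: firstP; exists m; exact: hm.1.
case: hm => hm1 hm2.
case: (ltngtP (tau x) m) => // h; [by case: (hm2 _ h)|by case: (h2 _ h)].
Qed.

Let tauS x : hit x -> ~ F x -> hit (T x) /\ tau x = (tau (T x)).+1.
Proof.
move=> hx nF; have [h1 h2] := firstP hx.
case: (tau x) h1 h2 (erefl (tau x)) => [//|m] h1 h2 E.
have hm : first (T x) m.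
  split; first by rewrite -iterSr.
  by move=> l lm; rewrite -iterSr; exact: h2.
by rewrite (first_uniq hm); split => //; exists m; exact: hm.1.
Qed.

Let tau_fibers : measurable_fibers tau.
Proof.
move=> m; rewrite (_ : mkset _ = [set x | (F (iter m T x) /\
  forall l, (l < m)%N -> ~ F (iter l T x)) \/ (~ (exists l, F (iter l T x)) /\ m = 0%N)]).
  apply: meas_or; apply: meas_and => //; last exact: meas_const.
    by apply: meas_all_lt => l; exact: meas_not.
  by apply: meas_not; exact: meas_ex.
apply/seteqP; split=> x /=; last first.
  move=> [/first_uniq//|[nh ->]]; rewrite /tau getPN// => m' [hm' _].
  by apply: nh; exists m'.
have [hx|nx] := pselect (hit x).
  by move=> <-; left; exact: firstP hx.
move=> <-; right; split => //; rewrite /tau getPN// => m' [hm' _].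
by apply: nx; exists m'.
Qed.

Let lev_fibers : measurable_fibers lev.
Proof. exact: (fibers_comp (fun t => (N - t %% N) %% N)%N tau_fibers). Qed.

Let levS x : hit x -> ~ F x -> lev (T x) = ((lev x).+1 %% N)%N.
Proof.
move=> hx nF; have [_ E] := tauS hx nF; rewrite /lev E.
exact: modn_countdown.
Qed.

Let nohit0 : 0 < pr mu [set x | F x] -> pr mu [set x | ~ hit x] = 0.
Proof.
move=> F0; rewrite (_ : mkset _ = ~` [set x | hit x])// pr_setC; last exact: meas_ex.
by rewrite hits_ae ?subrr.
Qed.

(** Passing to the next level loses at most the measure [q] of [F], so the [N] levels have measures
    within [N q <= 1 / (4 N)] of their mean [1 / N]. Almost every point of level [0] outside [F]
    climbs all [N] levels. *)
Lemma tower_of_small_set : 0 < pr mu [set x | F x] ->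
  pr mu [set x | F x] <= (4 * N%:R ^+ 2)^-1 ->
  [/\ measurable_fibers lev,
      forall i, (i < N)%N -> pr mu [set x | lev x = i] <= 2 / N%:R &
      (2 * N%:R)^-1 <= pr mu [set x | forall i, (i < N)%N -> lev (iter i T x) = i]].
Proof.
move=> F0 Fle.
have mhit : measurable [set x | hit x] by exact: meas_ex.
have mnhit : measurable [set x | ~ hit x] by exact: meas_not.
pose q := pr mu [set x | F x]; rewrite -/q in Fle F0.
pose a i := pr mu [set x | lev x = (i %% N)%N].
have N0 : (0 : R) < N%:R by rewrite ltr0n.
have aS i : a i <= q + a i.+1.
  rewrite /a -[X in _ + X](@pr_iter 1 (fun x => lev x = (i.+1 %% N)%N) (lev_fibers _)).
  have m1 : measurable [set x | lev (iter 1 T x) = (i.+1 %% N)%N].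
    exact: (meas_preim (meas_iter 1 mT) (lev_fibers _)).
  rewrite -[leRHS]add0r -(nohit0 F0) addrA.
  apply: (@le_trans _ _ (pr mu ([set x | ~ hit x] `|` [set x | F x]) +
    pr mu [set x | lev (iter 1 T x) = (i.+1 %% N)%N])).
    apply: pr_cover => //; first exact: measurableU.
    move=> x /= hx; have [hix|] := pselect (hit x); last by left; left.
    have [Fx|nFx] := pselect (F x); first by left; right.
    by right; rewrite (levS hix nFx) hx -addn1 modnDml addn1.
  by rewrite lerD2r; exact: pr_setU.
have aD k i : a i <= k%:R * q + a (i + k)%N.
  elim: k => [|k IH]; first by rewrite mul0r add0r addn0.
  by have := aS (i + k)%N; rewrite -natr1 addnS; lra.
have asum : \sum_(i < N) a i = 1.
  pose P x : 'I_N := inord (lev x).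
  have mP : measurable_fibers P by exact: (fibers_comp (fun t => inord t) lev_fibers).
  rewrite -(pr_sum_fibers mu mP); apply: eq_bigr => i _; congr pr.
  have levN x : (lev x < N)%N by rewrite ltn_mod.
  rewrite modn_small//; apply/seteqP; split=> x /=.
    by move=> h; apply/val_inj; rewrite /= inordK.
  by move=> <-; rewrite /= inordK.
have aN i : a (i %% N)%N = a i by rewrite /a modn_mod.
(* [a] is periodic, so every window of [N] indices has total mass 1. *)
have ashift i : \sum_(k < N) a (i + k)%N = 1.
  elim: i => [//|i IH]; rewrite -IH [RHS]big_ord_recl [LHS]big_ord_recr /= addrC.
  rewrite addn0 addSn -[a (i + N').+1]aN -addnS modnDr aN; congr (_ + _).
  by apply: eq_bigr => k _; rewrite /bump /= add1n addnS addSn.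
have qN : N%:R * (N%:R * q) <= 4^-1.
  by rewrite mulrA -expr2; move: Fle; rewrite invfM -ler_pdivlMl ?exprn_gt0// mulrC.
have sumN (c : R) : \sum_(k < N) c = N%:R * c by rewrite sumr_const card_ord mulr_natl.
have aub i : N%:R * a i <= N%:R * (N%:R * q) + 1.
  rewrite -[X in _ + X](ashift i) -[N%:R * a i]sumN -[N%:R * (_ * q)]sumN -big_split /=; apply: ler_sum => k _.
  apply: le_trans (aD k i) _; rewrite lerD2r ler_wpM2r ?pr_ge0//.
  by rewrite ler_nat ltnW.
(* Climbing from level [k] to level [N] takes [N - k] steps, and level [N] is level [0]. *)
have alb : 1 <= N%:R * (N%:R * q) + N%:R * a 0%N.
  rewrite -[leLHS]asum -[N%:R * a 0%N]sumN -[N%:R * (_ * q)]sumN -big_split /=; apply: ler_sum => k _.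
  have := aD (N - k)%N k; rewrite subnKC; last exact: ltnW.
  rewrite -(aN N) modnn => /le_trans; apply; rewrite lerD2r ler_wpM2r ?pr_ge0//.
  by rewrite ler_nat leq_subr.
split; first exact: lev_fibers.
  move=> i iN; have := aub i; rewrite /a modn_small// => h.
  by rewrite ler_pdivlMr// mulrC; lra.
have mQ : measurable [set x | forall i, (i < N)%N -> lev (iter i T x) = i].
  by apply: meas_all_lt => i; exact: (meas_preim (meas_iter i mT) (lev_fibers _)).
have : a 0%N <= q + pr mu [set x | forall i, (i < N)%N -> lev (iter i T x) = i].
  rewrite -[leRHS]add0r -(nohit0 F0) addrA.
  apply: (@le_trans _ _ (pr mu ([set x | ~ hit x] `|` [set x | F x]) +
    pr mu [set x | forall i, (i < N)%N -> lev (iter i T x) = i])); last first.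
    by rewrite lerD2r; exact: pr_setU.
  apply: pr_cover => //; first exact: measurableU.
  move=> x /= hx; have [hix|] := pselect (hit x); last by left; left.
  have [Fx|nFx] := pselect (F x); first by left; right.
  (* Outside [F] the time [tau x] is positive, and level [0] makes it a multiple of [N]; the orbit
     avoids [F] until then. *)
  right=> i iN; have tN : (N <= tau x)%N.
    have [_ E] := tauS hix nFx.
    apply: dvdn_leq; first by rewrite E.
    move: hx; rewrite mod0n /lev /dvdn; case: (_ %% _)%N (ltn_pmod (tau x) (isT : 0 < N)%N) => // m mN.
    by rewrite modn_small; [rewrite /N in mN *; lia|rewrite /N in mN *; lia].
  have [hi1 hi2] := firstP hix.
  elim: i iN => [_|i IH iN]; first by rewrite hx mod0n.
  rewrite iterS levS; first by rewrite IH ?modn_small// ltnW.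
    exists (tau x - i)%N; rewrite -iterD subnK; first exact: hi1.
    by rewrite ltnW// ltnW// (leq_trans iN).
  by apply: hi2; rewrite (leq_trans _ tN)// ltnW.
set b := pr mu _ => hb.
rewrite invfM ler_pdivrMr//; have := ler0n R N; have : (1 : R) <= N%:R by rewrite ler1n.
move: alb qN hb; rewrite -/q; set n : R := N%:R; set a0 := a 0%N => *.
have nq : 0 <= n * q by rewrite mulr_ge0 ?pr_ge0.
have : n * a0 <= n * (q + b) by rewrite ler_wpM2l.
have : n * q <= n * (n * q) by rewrite ler_peMl.
lra.
Qed.

End tower.

(* The level of [x] counts down, modulo [N], the time to the next visit of a
   small set. *)
Lemma tower_exists (N : nat) : (0 < N)%N ->
  (forall e : R, 0 < e -> exists2 E : set X, measurable E & 0 < pr mu E < e) ->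
  exists lev : X -> nat,
  [/\ measurable_fibers lev,
      forall i, (i < N)%N -> pr mu [set x | lev x = i] <= 2 / N%:R &
      (2 * N%:R)^-1 <= pr mu [set x | forall i, (i < N)%N -> lev (iter i T x) = i]].
Proof.
case: N => // N' _ small; have [|E mE /andP[E0 Ele]] := small (4 * N'.+1%:R ^+ 2)^-1.
  by rewrite invr_gt0 mulr_gt0// exprn_gt0.
by eexists; apply: (@tower_of_small_set N' E mE E0 (ltW Ele)).
Qed.

End recurrence.

(** * One stage of the construction *)

(** Bernoulli's inequality for [th^-1 = 1 + s] bounds [th ^ m] by [1 / (1 + m s)]; the choice
    [k = 2 m] squares this bound, which then beats the linear factor. *)
Lemma linear_geometric_small (R : realType) (th C : R) (L : nat) :
  0 <= th < 1 -> 0 <= C -> exists k : nat, C * (L * k).+1%:R * th ^+ k < 1.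
Proof.
move=> /andP[th0 th1] C0; have [->|thN0] := eqVneq th 0.
  by exists 1%N; rewrite expr1 mulr0 ltr01.
have thgt : 0 < th by rewrite lt_def thN0.
pose s := th^-1 - 1; have s0 : 0 < s by rewrite subr_gt0 invf_gt1.
have bern m : 1 + m%:R * s <= th^-1 ^+ m.
  elim: m => [|m IH]; first by rewrite mul0r addr0 expr0.
  have ms : 0 <= m%:R * s * s by rewrite !mulr_ge0// ltW.
  rewrite exprS (_ : th^-1 = 1 + s); last by rewrite /s; lra.
  rewrite (_ : th^-1 = 1 + s) in IH; last by rewrite /s; lra.
  have : (1 + s) * (1 + m%:R * s) <= (1 + s) * (1 + s) ^+ m by rewrite ler_wpM2l//; lra.
  by rewrite -natr1; lra.
(* A natural number [m] above [y] satisfies [C (2 L + 1) m < (m s)^2]. *)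
pose y := C * (2 * L%:R + 1) / (s * s).
have y0 : 0 <= y.
  by apply: divr_ge0; apply: mulr_ge0 => //; have := ler0n R L; lra.
have hm := archi_boundP y0; set m := Num.bound y in hm.
have m0 : (0 : R) < m%:R by exact: le_lt_trans hm.
have m1 : (1 : R) <= m%:R by rewrite ler1n -(ltr0n R).
have u0 : 0 < th ^+ m by rewrite exprn_gt0.
have hu : th ^+ m * (1 + m%:R * s) <= 1.
  by have := bern m; rewrite exprVn -[leRHS]mulr1 ler_pdivlMl.
exists (2 * m)%N; rewrite [(2 * m)%N]mulnC exprM.
have -> : (L * (m * 2)).+1%:R = 2 * L%:R * m%:R + 1 :> R.
  by rewrite -natr1 !natrM; ring.
move: hu u0; set u := th ^+ m => hu u0.
rewrite ltr_pdivrMr ?mulr_gt0// in hm.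
have ms0 : 0 < m%:R * s by rewrite mulr_gt0.
have h1 : C * (2 * L%:R * m%:R + 1) <= C * (2 * L%:R + 1) * m%:R.
  rewrite -[leRHS]mulrA ler_wpM2l//; have := ler0n R L; nra.
have h2 : C * (2 * L%:R + 1) * m%:R < (m%:R * s) ^+ 2.
  have : C * (2 * L%:R + 1) * m%:R < m%:R * (s * s) * m%:R by rewrite ltr_pM2r.
  by move/lt_le_trans; apply; rewrite le_eqVlt; apply/orP; left; apply/eqP; ring.
have h3 : (u * (m%:R * s)) ^+ 2 <= 1.
  have h : u * (m%:R * s) <= 1 by lra.
  by apply: exprn_ile1 => //; rewrite mulr_ge0 ?(ltW u0) ?(ltW ms0).
have : C * (2 * L%:R * m%:R + 1) * u ^+ 2 < (m%:R * s) ^+ 2 * u ^+ 2.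
  by rewrite ltr_pM2r ?exprn_gt0// (le_lt_trans h1).
by rewrite -exprMn [_ * u]mulrC => /lt_le_trans; apply.
Qed.

Section stage.
Context (R : realType) (d : measure_display) (X : measurableType d)
  (mu : probability X R) (T : X -> X).
Hypotheses (Tpres : measure_preserving mu T) (Terg : ergodic mu T).
Hypothesis small : forall e : R, 0 < e ->
  exists2 E : set X, measurable E & 0 < pr mu E < e.

Let mT : measurable_fun setT T := Tpres.1.

(* The stage is robust: its two estimates survive the removal of any set of
   measure at most [M'.+1^-1]. *)
Definition stage_spec (th dl : R) (L M : nat)
    (k : nat) (lev : X -> nat) (t M' : nat) : Prop :=
  [/\ measurable_fibers lev,
      pr mu [set x | (lev x <= L * k)%N] <= M.+1%:R^-1,
      forall V : set X, measurable V -> pr mu V <= M'.+1%:R^-1 ->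
        th ^+ k < pr mu [set x | forall i, (i < L * k)%N ->
          lev (iter i T x) = i /\ ~ V (iter i T x)] &
      forall V : set X, measurable V -> pr mu V <= M'.+1%:R^-1 ->
        1 - dl <= pr mu [set x |
          (exists2 i, (i < t)%N & lev (iter i T x) = (L * k)%N) /\
          forall i, (i < t)%N -> ~ V (iter i T x)]].

(** The order of choices matters: [k] depends on [th], [L] and [M] only, then come the tower and
    [t], and [M'] is chosen last, so that it can absorb both [n] and [t]. *)
Lemma stage_exists (th dl : R) (L M : nat) : 0 <= th < 1 -> 0 < dl ->
  exists k lev t M', stage_spec th dl L M k lev t M'.
Proof.
move=> thI dl0.
have [k hk] : exists k : nat, 8 * M.+1%:R * (L * k).+1%:R * th ^+ k < 1.
  by apply: linear_geometric_small => //; rewrite mulr_ge0.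
(* The [n + 1] levels up to [n] have total measure at most [2 (n + 1) / N = 1 / (M + 1)]. *)
pose n := (L * k)%N; pose N := (2 * M.+1 * n.+1)%N.
have N0 : (0 < N)%N by rewrite /N; lia.
have nN : (n < N)%N by rewrite /N; nia.
have [lev [mlev levle levQ]] := tower_exists Tpres Terg N0 small.
have Mn0 : (M.+1%:R : R) != 0 by rewrite pnatr_eq0.
have nn0 : (n.+1%:R : R) != 0 by rewrite pnatr_eq0.
(* Half of the lower bound [1 / (2 N)] for the points that climb the whole tower: one half may be
   lost to [V], and the other exceeds [th ^ k] by [hk]. *)
pose gm : R := (8 * M.+1%:R * n.+1%:R)^-1.
have gm0 : 0 < gm by rewrite invr_gt0 !mulr_gt0.
have mlevi i P : measurable [set x | P (lev (iter i T x))].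
  exact: (meas_preim (meas_iter i mT) (fibers_preim P mlev)).
(* A point that climbs the whole tower is on level [n] after [n] steps. *)
have E0 : 0 < pr mu [set x | lev x = n].
  rewrite -(@pr_iter _ _ _ _ _ Tpres n (fun x => lev x = n) (mlev n)).
  apply: (@lt_le_trans _ _ (2 * N%:R)^-1); first by rewrite invr_gt0 mulr_gt0 ?ltr0n.
  apply: le_trans levQ _; apply: le_pr; first by apply: meas_all_lt => i; exact: (mlevi i (eq^~ i)).
    exact: (mlevi n (eq^~ n)).
  by move=> x /= ->.
have [t ht] : exists t : nat, 1 - dl / 2 <
    pr mu [set x | exists2 i, (i < t)%N & lev (iter i T x) = n].
  rewrite -[X in X - _](hits_ae Tpres Terg (P := fun x => lev x = n) (mlev n) E0).
  apply: pr_ex_approx; last by rewrite divr_gt0.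
  by move=> i; exact: (mlevi i (eq^~ n)).
have n_gm : 0 <= n%:R / gm by apply: divr_ge0 => //; exact: ltW.
have t_dl : 0 <= 2 * t%:R / dl by apply: divr_ge0; [exact: mulr_ge0|exact: ltW].
have y0 := addr_ge0 n_gm t_dl.
(* A set of measure at most [1 / (M' + 1)] is then met within [n] steps with probability at most
   [gm], and within [t] steps with probability at most [dl / 2]. *)
have hM' := archi_boundP y0; set M' := Num.bound _ in hM'.
have M'0 : (0 : R) < M'.+1%:R by rewrite ltr0n.
have hM1 : n%:R * M'.+1%:R^-1 <= gm.
  rewrite ler_pdivrMr// mulrC -ler_pdivrMr//.
  by rewrite -natr1; lra.
have hM2 : t%:R * M'.+1%:R^-1 <= dl / 2.
  rewrite ler_pdivrMr// [leRHS]mulrAC ler_pdivlMr// mulrC [leRHS]mulrC.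
  rewrite -ler_pdivrMr//.
  by rewrite -natr1; lra.
have removal m V : measurable V -> pr mu V <= M'.+1%:R^-1 ->
    pr mu [set x | exists2 i, (i < m)%N & V (iter i T x)] <= m%:R * M'.+1%:R^-1.
  move=> mV Vle; apply: pr_ex_lt; first by move=> i; exact: (meas_preim (meas_iter i mT)).
  by move=> i _; rewrite (pr_iter Tpres).
have mVi V i : measurable V -> measurable [set x | V (iter i T x)].
  by move=> mV; exact: (meas_preim (meas_iter i mT)).
exists k, lev, t, M'; rewrite /stage_spec -/n; split=> //.
- rewrite (_ : mkset _ = [set x | exists2 i, (i < n.+1)%N & lev x = i]).
    apply: (@le_trans _ _ (n.+1%:R * (2 / N%:R))).
      by apply: pr_ex_lt => // i ilt; apply: levle; rewrite (leq_trans ilt).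
    rewrite /N !natrM !invfM le_eqVlt; apply/orP; left; apply/eqP.
    have := Mn0; have := nn0; move: (M.+1%:R : R) (n.+1%:R : R) => a b a0 b0.
    by field; rewrite a0 b0.
  by apply/seteqP; split=> x /=; [exists (lev x)|move=> [i + ->]].
- move=> V mV Vle; have := removal n V mV Vle.
  set A := [set x | exists2 i, _ & _]; set B := [set x | _] => hA.
  have mA : measurable A by apply: meas_ex_lt => i; exact: mVi.
  have mB : measurable B.
    apply: meas_all_lt => i; apply: meas_and; first exact: (mlevi i (eq^~ i)).
    by apply: meas_not; exact: mVi.
  have mQ : measurable [set x | forall i, (i < N)%N -> lev (iter i T x) = i].
    by apply: meas_all_lt => i; exact: (mlevi i (eq^~ i)).
  have hQ : (2 * N%:R)^-1 <= pr mu B + pr mu A.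
    apply: le_trans levQ _; apply: pr_cover => // x hx.
    have [Ax|nAx] := pselect (A x); [by right|left => i ilt; split].
      by apply: hx; exact: ltn_trans nN.
    by move=> Vi; apply: nAx; exists i.
  have hg : (2 * N%:R)^-1 = 2 * gm :> R.
    rewrite /N /gm !natrM; have := Mn0; have := nn0.
    by move: (M.+1%:R : R) (n.+1%:R : R) => a b a0 b0; field; rewrite a0 b0.
  have : th ^+ k < gm.
    by rewrite /gm -[ltRHS]mul1r ltr_pdivlMr ?mulr_gt0 ?ltr0n// mulrC.
have {hA} := le_trans hA hM1; move: hQ; rewrite hg => h1 h2 h3.
  by apply: lt_le_trans h3 _; rewrite -(lerD2r (pr mu A)); lra.
- move=> V mV Vle; have := removal t V mV Vle.
  set A := [set x | exists2 i, _ & _] => hA.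
  set B := [set x | _ /\ _].
  have mA : measurable A by apply: meas_ex_lt => i; exact: mVi.
  have mC : measurable [set x | exists2 i, (i < t)%N & lev (iter i T x) = n].
    by apply: meas_ex_lt => i; exact: (mlevi i (eq^~ n)).
  have mB : measurable B.
    by apply: meas_and => //; apply: meas_all_lt => i; apply: meas_not; exact: mVi.
  have : pr mu [set x | exists2 i, (i < t)%N & lev (iter i T x) = n] <= pr mu B + pr mu A.
    apply: pr_cover => // x hx; have [Ax|nAx] := pselect (A x); [by right|left].
    by split=> // i ilt Vi; apply: nAx; exists i.
  by have {hA} := le_trans hA hM2; move: ht => h1 h2 h3; rewrite -(lerD2r (pr mu A)); lra.
Qed.

End stage.

(** * The sequence of stages *)

(** [Some (j, s)] is the code letter of kind [j] that records [s]; [None] is a blank. *)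
Definition letter : Type := option (nat * seq int).
HB.instance Definition _ := Countable.on letter.
HB.instance Definition _ := Pointed.on letter.

Definition kind_below (j : nat) (a : letter) : bool :=
  if a is Some (i, _) then (i < j)%N else true.

(* The 2-adic valuation makes every word occur for infinitely many [j]; a word
   with a letter of kind at least [j] is replaced by the empty one. *)
Definition word (j : nat) : seq letter :=
  let w := odflt [::] (unpickle (logn 2 j.+1)) in
  if all (kind_below j) w then w else [::].

Lemma word_kind j i a : a = nth None (word j) i -> kind_below j a.
Proof.
move=> ->; rewrite /word; set w := odflt _ _.
have [h|_] := ifPn; last by rewrite nth_nil.
have [iw|iw] := ltnP i (size w); first exact: (allP h _ (mem_nth None iw)).
by rewrite nth_default.
Qed.

Lemma word_surj (w : seq letter) (J : nat) : exists2 j, (J <= j)%N & word j = w.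
Proof.
have [B hB] : exists B, all (kind_below B) w.
  elim: w => [|a w [B hB]]; first by exists 0%N.
  exists (maxn B (if a is Some (i, _) then i.+1 else 0%N)) => /=; apply/andP; split.
    by case: a => // -[i s] /=; rewrite leq_max ltnSn orbT.
  apply: sub_all hB => -[[i s]|]//= iB; exact: leq_trans (leq_maxl _ _).
(* The index with [j + 1 = 2^a (2 m + 1)] has valuation [a]; the odd factor pushes [j] past [J] and
   past every kind in [w], so that the filter in [word] keeps [w]. *)
pose m := (J + B)%N; pose a := pickle w.
have a0 : (0 < 2 ^ a)%N by rewrite expn_gt0.
have mle : (m < 2 ^ a * m.*2.+1)%N by rewrite -muln2; nia.
exists (2 ^ a * m.*2.+1).-1%N.
  by move: mle; rewrite /m; case: (_ * _)%N => // n; lia.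
rewrite /word prednK ?muln_gt0 ?a0//.
have -> : logn 2 (2 ^ a * m.*2.+1) = a.
  rewrite lognM// pfactorK// lognE/= dvdn2 /= odd_double/=; lia.
rewrite /a pickleK /= ifT//; apply: sub_all hB => -[[i s]|]//= iB.
by apply: leq_trans iB _; move: mle; rewrite /m; case: (_ * _)%N => // n; lia.
Qed.

Section stages.
Context (R : realType) (d : measure_display) (X : measurableType d)
  (mu : probability X R) (T : X -> X).
Hypotheses (Tpres : measure_preserving mu T) (Terg : ergodic mu T).
Hypothesis small : forall e : R, 0 < e ->
  exists2 E : set X, measurable E & 0 < pr mu E < e.

Let mT : measurable_fun setT T := Tpres.1.

Definition reps_len (k : nat -> nat) (j : nat) : nat := (size (word j) * k j)%N.

(** The levels below [reps_len k j] are for the repeated word; the level equal to it, also included,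
    is for the code letter. *)
Definition stage_set (k : nat -> nat) (lev : nat -> X -> nat) (j : nat) : set X :=
  [set x | (lev j x <= reps_len k j)%N].

Definition later_set (k : nat -> nat) (lev : nat -> X -> nat) (j : nat) : set X :=
  \bigcup_i stage_set k lev (j + i).+1.

(** The limit 1 puts this above any given letter probability less than 1 for all large [j]. *)
Definition ratio (j : nat) : R := 1 - j.+2%:R^-1.

(** The deficits [2^-(j + 1)] in the last estimate are summable, for the sake of Borel-Cantelli. *)
Definition stages_spec (k : nat -> nat) (lev : nat -> X -> nat) (t : nat -> nat) :=
  forall j, [/\ measurable_fibers (lev j),
   ratio j ^+ k j < pr mu [set x | forall i, (i < reps_len k j)%N ->
     lev j (iter i T x) = i /\ ~ later_set k lev j (iter i T x)] &
   1 - 1 / (2 ^ j.+1)%:R <= pr mu [set x |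
     (exists2 i, (i < t j)%N & lev j (iter i T x) = reps_len k j) /\
     forall i, (i < t j)%N -> ~ later_set k lev j (iter i T x)]].

Lemma measurable_stage_set k lev t j : stages_spec k lev t ->
  measurable (stage_set k lev j).
Proof.
move=> /(_ j)[h _ _]; exact: (fibers_preim (fun l => l <= reps_len k j)%N h).
Qed.

Lemma measurable_later_set k lev t j : stages_spec k lev t ->
  measurable (later_set k lev j).
Proof.
by move=> h; apply: bigcupT_measurable => i; exact: (measurable_stage_set _ h).
Qed.

Lemma stages_exist : exists k lev t, stages_spec k lev t.
Proof.
have st (jM : nat * nat) : exists q : nat * (X -> nat) * nat * nat,
  stage_spec mu T (ratio jM.1) (1 / (2 ^ jM.1.+1)%:R) (size (word jM.1)) jM.2
    q.1.1.1 q.1.1.2 q.1.2 q.2.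
  have h2 : 0 <= ratio jM.1 < 1.
    rewrite /ratio subr_ge0 invf_le1// ler1n/= ltrBlDr ltrDl invr_gt0.
    by rewrite ltr0n.
  have [|k [lev [t [M' h]]]] := stage_exists Tpres Terg small (size (word jM.1)) jM.2 h2
    (dl := 1 / (2 ^ jM.1.+1)%:R).
    by rewrite divr_gt0// ltr0n expn_gt0.
  by exists (k, lev, t, M').
have {st}[q hq] := choice st.
(* [Ms j] dictates how small stage [j] must be. If [M'] is the tolerance of stage [j], its growth
   bounds the measure of stage [j + i + 1] by [2^-(i + 1) / (M' + 1)], so all later stages together
   stay within [1 / (M' + 1)]. *)
pose Ms := fix Ms j := if j is i.+1 then
  (2 * (q (i, Ms i)).2.+1 * (Ms i).+1)%N else 0%N.
pose Q j := q (j, Ms j).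
pose k j := (Q j).1.1.1; pose lev j := (Q j).1.1.2; pose t j := (Q j).1.2.
exists k, lev, t => j.
have mU i : measurable (stage_set k lev i).
  by have [h _ _ _] := hq (i, Ms i); exact: (fibers_preim (fun l => l <= reps_len k i)%N h).
have mV : measurable (later_set k lev j) by apply: bigcupT_measurable => i; exact: mU.
have MsS i : (Ms i.+1 = 2 * (Q i).2.+1 * (Ms i).+1)%N by [].
have growth i : ((Q j).2.+1 * 2 ^ i.+1 <= (Ms (j + i).+1).+1)%N.
  elim: i => [|i IH]; first by rewrite addn0 MsS; nia.
  rewrite addnS MsS expnS; move: IH; set a := (2 ^ i.+1)%N; set b := (Ms _).+1; nia.
have hV : pr mu (later_set k lev j) <= (Q j).2.+1%:R^-1.
  apply: pr_bigcup_geometric => // i; have [_ h _ _] := hq ((j + i).+1, Ms (j + i).+1).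
  apply: le_trans h _; rewrite -invfM -natrM.
  by rewrite lef_pV2 ?posrE ?ltr0n ?muln_gt0 ?expn_gt0// ler_nat.
have [h1 h2 h3 h4] := hq (j, Ms j).
by split => //; [exact: h3|exact: h4].
Qed.

End stages.

(** * The labelling and its decoding *)

Lemma coord_fibers (A : pointedType) (i : int) :
  measurable_fibers (fun y : bisequence A => y i).
Proof. by move=> s; apply: sub_sigma_algebra; exists i, (eq^~ s). Qed.

Lemma fibers_floor (R : realType) (d : measure_display) (X : measurableType d)
    (c : R) (f : X -> R) : measurable_fun setT f ->
  measurable_fibers (fun x => Num.floor (c * f x)).
Proof.
move=> mf z; have mcf : measurable_fun setT (fun x => c * f x).
  by apply: measurable_funM => //; exact: measurable_cst.
rewrite (_ : mkset _ = (fun x => c * f x) @^-1` `[z%:~R, (z + 1)%:~R[%classic).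
  by rewrite -[_ @^-1` _]setTI; apply: mcf => //; exact: measurable_itv.
apply/seteqP; split=> x /=; rewrite in_itv /=.
  by move=> <-; exact: floor_itv.
by move=> h; exact: floor_def.
Qed.

Section coding.
Context (R : realType) (d : measure_display) (X : measurableType d)
  (mu : probability X R) (T psi : X -> X) (f : X -> R).
Hypotheses (Tpres : measure_preserving mu T).
Hypotheses (mpsi : measurable_fun setT psi).
Hypothesis psiK : {ae mu, forall x, psi (T x) = x}.
Hypothesis mf : measurable_fun setT f.
Variables (k t : nat -> nat) (lev : nat -> X -> nat).
Hypothesis spec : stages_spec mu T k lev t.

Let mT : measurable_fun setT T := Tpres.1.
Let U := stage_set k lev.
Let V := later_set k lev.
Let n := reps_len k.

(** Where [psi] undoes [T] along the orbit, entry [i < t j] of the history at [T^i x] is the integer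
    part of [(j + 1) f x]: a code letter met [i] steps later still describes [x]. *)
Definition history (j : nat) (x : X) : seq int :=
  mkseq (fun i => Num.floor (j.+1%:R * f (iter i psi x))) (t j).

(** For an empty word [n j = 0], so the branch that reduces modulo the word length is not
    entered. *)
Definition stage_letter (j : nat) (x : X) : letter :=
  if (lev j x < n j)%N then nth None (word j) (lev j x %% size (word j))
  else Some (j, history j x).

(** The label comes from the last stage that contains [x], which is unique when it exists; without
    one the label is blank. *)
Definition label (x : X) : letter :=
  let j := get [set j | U j x /\ ~ V j x] in
  if `[< U j x /\ ~ V j x >] then stage_letter j x else None.

Lemma label_stage j x : U j x -> ~ V j x -> label x = stage_letter j x.
Proof.
move=> Uj Vj; rewrite /label; set i := get _.
have [Ui Vi] : [set j | U j x /\ ~ V j x] i by apply: getPex; exists j.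
rewrite asboolT//; congr stage_letter; case: (ltngtP i j) => // ij.
  by case: Vi; exists (j - i.+1)%N => //; rewrite -addSn subnKC.
by case: Vj; exists (i - j.+1)%N => //; rewrite -addSn subnKC.
Qed.

(** Inside a repeated word, a code letter of kind [j] can only be spelled by a stage after [j],
    since [word i] has kinds below [i]; off [V j] no such stage contains [x]. *)
Lemma label_genuine j s x : ~ V j x -> label x = Some (j, s) ->
  lev j x = n j /\ s = history j x.
Proof.
move=> Vj; rewrite /label; set i := get _; case: asboolP => // -[Ui Vi].
rewrite /stage_letter; case: ltnP => [_ h|nle [ij hs]].
  have := word_kind (esym h) => /= ji; case: Vj; exists (i - j.+1)%N => //.
  by rewrite -addSn subnKC.
rewrite -ij -hs; split => //; apply/eqP; rewrite eqn_leq nle andbT.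
exact: Ui.
Qed.

Lemma label_fibers : measurable_fibers label.
Proof.
have mU j : measurable [set x | U j x] by exact: (measurable_stage_set _ spec).
have mV j : measurable [set x | V j x] by exact: (measurable_later_set _ spec).
have mh j : measurable_fibers (history j).
  apply: fibers_mkseq => i; exact: (fibers_pull (meas_iter i mpsi) (fibers_floor _ mf)).
have ms j : measurable_fibers (stage_letter j).
  have [h _ _] := spec j; move=> a; rewrite (_ : mkset _ = [set x |
    ((lev j x < n j)%N /\ nth None (word j) (lev j x %% size (word j)) = a) \/
    (~ (lev j x < n j)%N /\ Some (j, history j x) = a)]).
    apply: meas_or; apply: meas_and.
    - exact: (fibers_preim (fun l => l < n j)%N h).
    - exact: (fibers_preim (fun l => nth None (word j) (l %% size (word j)) = a) h).
    - by apply: meas_not; exact: (fibers_preim (fun l => l < n j)%N h).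
    - exact: (fibers_preim (fun s => Some (j, s) = a) (mh j)).
  apply/seteqP; split=> x /=; rewrite /stage_letter.
    by case: ifPn => [h1|/negP h1] <-; [left|right].
  by case=> -[]; [move=> ->|move=> /negP/negbTE ->].
move=> a; rewrite (_ : mkset _ = [set x |
   (exists j, (U j x /\ ~ V j x) /\ stage_letter j x = a) \/
   (~ (exists j, U j x /\ ~ V j x) /\ None = a)]).
  have mUV j : measurable [set x | U j x /\ ~ V j x].
    by apply: meas_and => //; exact: meas_not.
  apply: meas_or; first by apply: meas_ex => j; apply: meas_and => //; exact: ms.
  by apply: meas_and; [apply: meas_not; exact: meas_ex|exact: meas_const].
apply/seteqP; split=> x /=.
  have [[j [Uj Vj]]|nj] := pselect (exists j, U j x /\ ~ V j x).
    by rewrite (label_stage Uj Vj); left; exists j.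
  by move=> <-; right; split=> //; rewrite /label asboolF// => h; apply: nj; eexists; exact: h.
case=> [[j [[Uj Vj] <-]]|[nj <-]]; first by rewrite (label_stage Uj Vj).
by rewrite /label asboolF// => h; apply: nj; eexists; exact: h.
Qed.

Definition iterz (i : int) (x : X) : X :=
  match i with Posz m => iter m T x | Negz m => iter m.+1 psi x end.

Definition name (x : X) : bisequence letter := fun i => label (iterz i x).

Lemma meas_iterz i : measurable_fun setT (iterz i).
Proof. by case: i => m; exact: meas_iter. Qed.

Lemma measurable_name : measurable_fun setT name.
Proof.
apply: (@measurability _ _ X (bisequence letter) setT name (@coordinate_sets letter)) => // _ [_ [i [E ->]] <-].
rewrite setTI.
exact: (fibers_preim E (fibers_pull (meas_iterz i) label_fibers)).
Qed.

(** At negative indices a single [psi] cancels against the first [T], so the identity is needed at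
    the point [x] only. *)
Lemma name_shift x : psi (T x) = x -> name (T x) = left_shift (name x).
Proof.
move=> h; apply/funext => -[m|[|m]]; rewrite /left_shift /name.
- by rewrite (_ : Posz m + 1 = Posz m.+1)/= -?iterSr//; lia.
- by rewrite (_ : Negz 0 + 1 = 0)//= h.
- rewrite (_ : Negz m.+1 + 1 = Negz m); last by rewrite !NegzE; lia.
  by congr label; rewrite /iterz iterSr h.
Qed.

(** The first code letter of kind [j] also acts as a clock: its position tells which entry of its
    history describes the starting point. *)
Definition decode_stage (j : nat) (l : seq letter) : R :=
  if nth None l (find (fun a => omap fst a == Some j) l) is Some (_, s)
  then (nth 0 s (find (fun a => omap fst a == Some j) l))%:~R / j.+1%:R else 0.

Definition decode_approx (j : nat) (y : bisequence letter) : R :=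
  decode_stage j (mkseq (fun i => y i%:Z) (t j)).

(** An upper limit is measurable in [y] without any convergence; on almost every name it is a
    limit. *)
Definition decode (y : bisequence letter) : R :=
  fine (limn_esup (fun j => (decode_approx j y)%:E)).

Lemma measurable_decode : measurable_fun setT decode.
Proof.
apply: (measurableT_comp (fine_measurable measurableT)).
apply: measurable_fun_limn_esup => j; apply: measurableT_comp => //.
apply: (fibers_measurable (decode_stage j)); apply: fibers_mkseq => i.
exact: coord_fibers.
Qed.

Definition good (j : nat) : set X := [set x |
  (exists2 i, (i < t j)%N & lev j (iter i T x) = n j) /\
  forall i, (i < t j)%N -> ~ V j (iter i T x)].

(** The visit to level [n j] shows a code letter of kind [j] in the window. The first one, at
    position [m], is genuine because the window avoids [V j], and its entry [m] was computed at
    [psi^m (T^m x) = x]. *)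
Lemma decode_approxP j x : (forall i, iter i psi (iter i T x) = x) -> good j x ->
  `|f x - decode_approx j (name x)| <= j.+1%:R^-1.
Proof.
move=> hpsi [[i it li] nV]; rewrite /decode_approx /decode_stage.
set l := mkseq _ _; set p := fun a => _.
have hl m : (m < t j)%N -> nth None l m = label (iter m T x).
  by move=> mt; rewrite nth_mkseq.
have hasp : has p l.
  apply/(hasP); exists (label (iter i T x)).
    by rewrite -hl// mem_nth// size_mkseq.
  rewrite (@label_stage j) /p /stage_letter ?li ?ltnn//=.
    by rewrite /U /stage_set /= li.
  exact: nV.
have := nth_find None hasp; rewrite has_find size_mkseq in hasp.
move: hasp; set m := find p l => mt.
rewrite hl//; case E : (label _) => [[j' s]|]// /eqP [ej]; rewrite ej in E.
have [_ ->] := label_genuine (nV _ mt) E.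
rewrite nth_mkseq// hpsi; have /andP[] := floor_itv (j.+1%:R * f x).
rewrite intrD; set z := _%:~R => h1 h2.
have j0 : (0 : R) < j.+1%:R by rewrite ltr0n.
rewrite -[X in X - _](mulKf (lt0r_neq0 j0)) mulrC -mulrBl.
rewrite normrM [`|_^-1|]gtr0_norm ?invr_gt0// ler_piMl ?invr_ge0// ler_norml.
by apply/andP; split; lra.
Qed.

Lemma iter_psiK : {ae mu, forall x, forall i, psi (T (iter i T x)) = iter i T x}.
Proof.
apply: ae_foralln => i.
exact: (@ae_iter _ _ _ mu T Tpres i (fun x => psi (T x) = x) psiK).
Qed.

(** Borel-Cantelli, the complement of [good j] having measure at most [2^-(j + 1)]. *)
Lemma eventually_good : {ae mu, forall x, exists J, forall j, (J <= j)%N -> good j x}.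
Proof.
have mV j : measurable (V j) by exact: (measurable_later_set _ spec).
have mgood j : measurable (good j).
  have [h _ _] := spec j; apply: meas_and.
    by apply: meas_ex_lt => i; exact: (fibers_pull (meas_iter i mT) h).
  apply: meas_all_lt => i; apply: meas_not.
  exact: (meas_preim (meas_iter i mT) (mV j)).
have mF j : measurable (~` good j) by exact: measurableC.
have /(lim_sup_set_cvg0 mF) F0 :
    (\sum_(0 <= j <oo) mu (~` good j)%classic < +oo)%E.
  apply: (@le_lt_trans _ _ 1%E); last by rewrite ltry.
  apply: le_trans (epsilon_trick0 xpredT ler01); apply: lee_nneseries => // j _.
  have [_ _ hj] := spec j; rewrite (_ : mu _ = (pr mu (~` good j))%:E); last exact: prE.
  rewrite lee_fin pr_setC//.
  by rewrite lerBlDr -lerBlDl.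
exists (lim_sup_set (fun j => ~` good j)); split => //.
  by apply: bigcapT_measurable => i; apply: bigcup_measurable => j _.
move=> x nx m _; apply: contrapT => nj; apply: nx; exists m => j mj.
by apply: contrapT => ng; apply: nj; exists j.
Qed.

Lemma decode_name : {ae mu, forall x, decode (name x) = f x}.
Proof.
apply: filterS2 iter_psiK eventually_good => x h1 [J hJ].
have hx i : iter i psi (iter i T x) = x.
  by elim: i => // i IH; rewrite iterSr iterS h1.
suff /cvg_limn_einf_sup[_ h] :
    ((decode_approx j (name x))%:E @[j --> \oo] --> (f x)%:E)%E.
  by rewrite /decode h.
apply: cvg_EFin; first exact: nearW.
apply/cvgrPdist_le => e e0; near=> j.
have Jj : (J <= j)%N by near: j; exact: nbhs_infty_ge.
apply: le_trans (decode_approxP hx (hJ _ Jj)) _; apply: ltW.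
near: j; exact: (near_infty_natSinv_lt (PosNum e0)).
Unshelve. all: end_near.
Qed.

End coding.

(** * Processes and finitary factors *)

Lemma pr_le_ae (R : realType) (d : measure_display) (X : measurableType d)
    (mu : probability X R) (A B : set X) : measurable A -> measurable B ->
  {ae mu, forall x, A x -> B x} -> pr mu A <= pr mu B.
Proof.
move=> mA mB [N [mN N0 hN]].
have -> : pr mu B = pr mu B + pr mu N by rewrite [in X in _ + X]/pr N0 addr0.
apply: pr_cover => // x Ax; have [Nx|nNx] := pselect (N x); first by right.
by left; apply: contrapT => nB; apply: nNx; apply: hN => /= h; apply: nB; exact: h.
Qed.

Lemma pushforward_exists (R : realType) (d d' : measure_display)
    (X : measurableType d) (Y : measurableType d') (mu : probability X R)
    (f : X -> Y) : measurable_fun setT f ->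
  exists nu : probability Y R, forall E, nu E = mu (f @^-1` E).
Proof.
move=> mf; pose g : {mfun X >-> Y} := mfun_Sub (mem_set mf).
by exists (distribution mu g).
Qed.

Lemma standard_coordinate (R : realType) (d : measure_display)
    (X : measurableType d) (mu : probability X R) : standard_probability mu ->
  exists (f : X -> R) (g : R -> X), [/\ measurable_fun setT f,
    measurable_fun setT g & {ae mu, forall x, g (f x) = x}].
Proof.
move=> [D [f [mD D0 mf finj fim]]].
pose g r := if pselect (exists x, D x /\ f x = r) is left h then projT1 (cid h) else point.
have gP x : D x -> g (f x) = x.
  move=> Dx; rewrite /g; case: pselect => [h|[]]; last by exists x.
  by case: cid => x' [Dx' e] /=; apply: finj => //; exact/mem_set.
(* Setting [f] to zero off [D] makes it measurable on the whole space. *)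
exists (f \_ D), g; split.
- exact: (measurable_restrictT f mD).1.
- move=> _ E mE; rewrite setTI.
  (* Images under [f] of measurable parts of [D] are Borel; off the image of [D] the map [g] is
     constantly [point]. *)
  rewrite (_ : _ @^-1` _ = (f @` (E `&` D)) `|`
      (~` (f @` D) `&` [set _ | E point])).
    apply: measurableU; first by apply: fim; [exact: measurableI|exact: subIsetr].
    apply: measurableI; last exact: meas_const.
    by apply: measurableC; exact: fim.
  apply/seteqP; split=> r /=.
    rewrite /g; case: pselect => [h|nh] Er; last first.
      by right; split => // -[x Dx e]; apply: nh; exists x.
    by left; move: Er; case: cid => x [Dx e] /= Ex; exists x.
  move=> [[x [Ex Dx] <-]|[nD Ep]]; first by rewrite gP.
  by rewrite /g; case: pselect => // -[x [Dx e]]; case: nD; exists x.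
- exists (~` D); split => //; first exact: measurableC.
  move=> x /= h; apply: contra_not h => Dx.
  by rewrite patchE mem_set// gP.
Qed.

Lemma measurable_left_shift (A : pointedType) : measurable_fun setT (@left_shift A).
Proof.
apply: (@measurability _ _ (bisequence A) (bisequence A) setT _ (@coordinate_sets A)) => //.
move=> _ [_ [i [E ->]] <-]; rewrite setTI; apply: sub_sigma_algebra.
by exists (i + 1), E.
Qed.

Lemma iter_left_shift (A : pointedType) m (y : bisequence A) i :
  iter m (@left_shift A) y i = y (i + m%:Z).
Proof.
elim: m y i => [|m IH] y i; first by rewrite addr0.
by rewrite iterS /left_shift IH; congr y; lia.
Qed.

(** * Exponential decay of repeated words over a finitary i.i.d. factor *)

Section finitary_bound.
Context (R : realType) (A B : pointedType).
Variables (nu : probability (bisequence A) R) (rho : probability (bisequence B) R).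
Variable (p : B -> R).
Hypotheses (nu_pres : measure_preserving nu (@left_shift A)) (rho_iid : iid_process p rho).

Lemma iid_pow (s : seq int) b : uniq s ->
  pr rho [set z | forall i : int, i \in s -> z i = b] = p b ^+ size s.
Proof.
have [p0 _ h] := rho_iid => us; rewrite /pr (h s (fun=> [set b]) us).
under eq_bigr do rewrite esum_set1 ?lee_fin//.
rewrite (_ : (\prod_(i <- s) _)%E = (p b ^+ size s)%:E)//.
by elim: {us}s => [|a s IH]; rewrite ?big_nil// big_cons IH exprS.
Qed.

Lemma iid_lt1 b : p b != 1 -> p b < 1.
Proof.
move=> pb1; rewrite lt_neqAle pb1 -[p b]expr1 -(@iid_pow [:: 0] b isT) pr_le1//.
by apply: meas_all => i; apply: meas_imp; [exact: meas_const|exact: coord_fibers].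
Qed.

(** The window of [x] forces the letter [b] at its centre. Its [k]-fold repetition forces [b] at [k]
    distinct places, which are independent under [rho]. *)
Lemma finitary_factor_bound : finitary_factor nu rho ->
  exists (x : bisequence A) (r : nat) (b : B), forall k : nat,
    pr nu [set y | forall i, (i < r.*2.+1 * k)%N ->
      y i%:Z = x ((i %% r.*2.+1)%:Z - r%:Z)] <= p b ^+ k.
Proof.
move=> [phi [[mphi phiS phi_pres] fin]].
(* A property that holds almost everywhere holds at some point, because the whole space is not
   null. *)
have [x [r [b hb]]] : exists x : bisequence A, exists (r : nat) (b : B),
    {ae nu, forall x' : bisequence A,
      (forall i : int, - r%:Z <= i <= r%:Z -> x' i = x i) -> phi x' 0 = b}.
  apply: contrapT => nx; have [N [mN N0 hN]] := fin.
  have NT : N = setT.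
    by apply/seteqP; split => // y _; apply: hN => /= -[r [b h]]; apply: nx; exists y, r, b.
  have := @pr_setT _ _ _ nu; rewrite /pr -NT N0 /= => /eqP.
  by rewrite eq_sym oner_eq0.
exists x, r, b => k; set L := r.*2.+1.
have hS : {ae nu, forall y, forall m, phi (left_shift (iter m (@left_shift A) y)) =
    left_shift (phi (iter m (@left_shift A) y))}.
  apply: ae_foralln => m; exact: (ae_iter nu_pres m phiS).
have hB : {ae nu, forall y, forall m, (forall i : int, - r%:Z <= i <= r%:Z ->
    iter m (@left_shift A) y i = x i) -> phi (iter m (@left_shift A) y) 0 = b}.
  apply: ae_foralln => m; exact: (ae_iter nu_pres m hb).
(* The centres of the [k] consecutive blocks of length [L]. *)
pose s : seq int := [seq (l * L + r)%N%:Z | l <- iota 0 k].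
have us : uniq s.
  rewrite map_inj_uniq ?iota_uniq// => l l' [] /eqP.
  by rewrite eqn_add2r eqn_pmul2r// => /eqP.
have -> : p b ^+ k = pr nu (phi @^-1` [set z | forall i : int, i \in s -> z i = b]).
  have mE : measurable [set z : bisequence B | forall i : int, i \in s -> z i = b].
    by apply: meas_all => i; apply: meas_imp; [exact: meas_const|exact: coord_fibers].
  by rewrite /pr phi_pres// -/(pr rho _) (iid_pow _ us) size_map size_iota.
apply: pr_le_ae.
- by apply: meas_all_lt => i; exact: coord_fibers.
- apply: (meas_preim mphi); apply: meas_all => i; apply: meas_imp; first exact: meas_const.
  exact: coord_fibers.
apply: filterS2 hS hB => y hS hB Cy _ /mapP[l + ->]; rewrite mem_iota add0n => /andP[_ lk].
have -> : phi y (l * L + r)%N = phi (iter (l * L + r) (@left_shift A) y) 0.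
  have -> : phi (iter (l * L + r) (@left_shift A) y) =
      iter (l * L + r) (@left_shift B) (phi y).
    by elim: (l * L + r)%N => [//|m IH]; rewrite iterS hS IH.
  by rewrite iter_left_shift add0r.
apply: hB => i ir; rewrite iter_left_shift.
(* [q] is the offset of the coordinate [i] from the left end of its block. *)
pose q := absz (i + r%:Z); have qE : i = q%:Z - r%:Z by rewrite /q; lia.
have qL : (q < L)%N by rewrite /L /q; lia.
rewrite (_ : i + _ = (l * L + q)%N%:Z); last by rewrite qE; lia.
rewrite Cy; last by rewrite mulnC; nia.
by rewrite modnMDl modn_small// -qE.
Qed.

End finitary_bound.

(** Isomorphism with a two-sided shift forces [T] to be invertible modulo null sets, whence [hinv].
    The condition [p b != 1] excludes the one-point process, a trivial finitary factor of every
    process. *)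
Theorem theorem1p3 (R : realType) (d : measure_display) (X : measurableType d)
    (mu : probability X R) (T : X -> X)
    (hstd : standard_probability mu)
    (hpres : measure_preserving mu T)
    (hinv : invertible_mod0 mu mu T)
    (herg : ergodic mu T)
    (hent : (0 < ks_entropy mu T)%E) :
  exists (A : pointedType) (nu : probability (bisequence A) R),
    [/\ countable [set: A],
        measure_preserving nu (@left_shift A),
        isomorphic mu T nu (@left_shift A) &
        forall (B : pointedType) (p : B -> R)
          (rho : probability (bisequence B) R),
          iid_process p rho -> (forall b : B, p b != 1) ->
          ~ finitary_factor nu rho].
Proof.
have [psi [mpsi psiK _]] := hinv.
have [f [g [mf mg gf]]] := standard_coordinate hstd.
have small := entropy_small_sets hpres.1 hent.
have [k [lev [t spec]]] := stages_exist hpres herg small.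
pose nm := name T psi f k t lev.
have mnm : measurable_fun setT nm by exact: (measurable_name hpres mpsi mf spec).
have [nu nuE] := pushforward_exists mu mnm.
have nm_shift x : psi (T x) = x -> nm (T x) = left_shift (nm x) by exact: name_shift.
have mshift := @measurable_left_shift letter.
have nu_pres : measure_preserving nu (@left_shift letter).
  split=> // E mE.
  have mE' : measurable (nm @^-1` E) by exact: (meas_preim mnm mE).
  have mSE : measurable (nm @^-1` (@left_shift letter @^-1` E)).
    exact: (meas_preim mnm (meas_preim mshift mE)).
  have mTE : measurable [set x | E (nm (T x))] by exact: (meas_preim hpres.1 mE').
  rewrite !nuE (prE _ mSE) (prE _ mE') -(@pr_iter _ _ _ mu T hpres 1 _ mE') /=.
  (* The name intertwines [T] and the shift only almost everywhere, so the two events are compared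
     up to a null set. *)
  congr EFin; apply/eqP; rewrite eq_le; apply/andP; split; apply: pr_le_ae => //.
    by apply: filterS psiK => x hx /=; rewrite nm_shift.
  by apply: filterS psiK => x hx /=; rewrite nm_shift.
exists letter, nu; split=> //.
- exact: countableP.
- exists nm; split.
    by split=> //; apply: filterS psiK => x; exact: nm_shift.
  have mdec := @measurable_decode R t.
  have gdec : {ae mu, forall x, g (decode R t (nm x)) = x}.
    have hdec := decode_name f hpres psiK spec.
    by apply: filterS2 gf hdec => x h1 h2; rewrite h2.
  have mgd : measurable_fun setT (g \o @decode R t) by exact: measurableT_comp.
  exists (g \o @decode R t); split=> //.
  (* Agreement of two bisequences is tested coordinate by coordinate and letter by letter, over
     countable sets. *)
  have mZ : measurable [set y : bisequence letter | nm (g (decode R t y)) = y].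
    rewrite (_ : mkset _ = [set y | forall i : int, exists a : letter,
        nm (g (decode R t y)) i = a /\ y i = a]).
      apply: meas_all => i; apply: meas_ex => a; apply: meas_and; last exact: coord_fibers.
      exact: (meas_preim (measurableT_comp mnm mgd) (coord_fibers i a)).
    apply/seteqP; split=> y /= h; first by move=> i; exists (y i); rewrite h.
    by apply/funext => i; have [a [-> ->]] := h i.
  have mZC := measurableC mZ.
  exists (~` [set y : bisequence letter | nm (g (decode R t y)) = y]); split=> //.
  have mZC' := meas_preim mnm mZC.
  (* Almost no name lies in the exceptional set, since decoding [nm x] and applying [g] gives back
     [x]. *)
  rewrite nuE (prE _ mZC'); congr EFin; apply/eqP; rewrite eq_le pr_ge0 andbT.
  rewrite -[leRHS](_ : pr mu set0 = 0); last by rewrite /pr measure0.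
  apply: pr_le_ae => //.
  by apply: filterS gdec => x h /=; rewrite h.
- move=> B p rho rho_iid p1 ff.
  have [x [r [b hb]]] := finitary_factor_bound nu_pres rho_iid ff.
  have pb1 := iid_lt1 rho_iid (p1 b).
  have pb0 : 0 <= p b by case: rho_iid.
  have y0 : 0 <= (1 - p b)^-1 by rewrite invr_ge0 subr_ge0 ltW.
  pose w := mkseq (fun i => x (i%:Z - r%:Z) : letter) r.*2.+1.
  (* The word [w] recurs arbitrarily late; beyond [1 / (1 - p b)] the ratio [1 - 1 / (j + 2)] is at
     least [p b]. *)
  have [j Jj wj] := word_surj w (Num.bound (1 - p b)^-1).
  have [_ hj _] := spec j.
  have pr_ratio : p b <= ratio R j.
    rewrite /ratio lerBrDr -lerBrDl -[leRHS]invrK lef_pV2 ?posrE ?invr_gt0 ?subr_gt0 ?ltr0n//.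
    apply: ltW; apply: lt_le_trans (archi_boundP y0) _.
    by rewrite ler_nat; lia.
  have sw : size (word j) = r.*2.+1 by rewrite wj size_mkseq.
  suff : ratio R j ^+ k j < p b ^+ k j.
    by apply/negP; rewrite -leNgt lerXn2r ?nnegrE// (le_trans pb0).
  apply: lt_le_trans hj _; apply: le_trans (hb (k j)).
  have mC : measurable [set y : bisequence letter | forall i, (i < r.*2.+1 * k j)%N ->
      y i%:Z = x ((i %% r.*2.+1)%:Z - r%:Z)].
    by apply: meas_all_lt => i; exact: coord_fibers.
  (* In the event of stage [j] the orbit climbs the levels [0, 1, ...] outside all later stages, so
     its name starts with [w] repeated [k j] times. *)
  rewrite [leRHS]/pr nuE -/(pr mu _); apply: le_pr; last 1 first.
    move=> z /= hz i; rewrite -sw => ilt; have [li nV] := hz i ilt.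
    rewrite /nm /name /= (label_stage _ _ _ _ nV); last first.
      by rewrite /stage_set /= li ltnW.
    by rewrite /stage_letter li ilt sw wj nth_mkseq// ltn_mod.
  - apply: meas_all_lt => i; apply: meas_and.
      by have [h _ _] := spec j; exact: (fibers_pull (meas_iter i hpres.1) h).
    apply: meas_not; exact: (meas_preim (meas_iter i hpres.1) (measurable_later_set j spec)).
  - exact: (meas_preim mnm mC).
Qed.
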